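(* Let $s$ be a finite signature consisting of unary and binary relation symbols. Every minimal prime hereditary class of finite structures of signature $s$ is the age of some prime structure; furthermore, this age is well-quasi-ordered by embeddability.
   Context: Structures of signature $s$ are $\mathcal R=(V,(\rho_i)_{i\in I})$ ($I$ finite), each $\rho_i$ being a binary or unary relation on $V$. $\mathcal R\le \mathcal R'$ (embeddability) means $\mathcal R$ is isomorphic to an induced substructure of $\mathcal R'$. A class $\mathcal C$ of finite structures is hereditary if $\mathcal R\le\mathcal R'\in\mathcal C$ implies $\mathcal R\in\mathcal C$. The age $\mathrm{Age}(\mathcal R)$ of a (possibly infinite) structure $\mathcal R$ is the class of finite structures, up to isomorphism, that embed in $\mathcal R$. A module of $\mathcal R$ is a subset $A\subseteq V$ such that for all $a,a'\in A$, $x\in V\setminus A$ and all $i\in I$ with $\rho_i$ binary: $(x\rho_i a\Leftrightarrow x\rho_i a')$ and $(a\rho_i x\Leftrightarrow a'\rho_i x)$ (unary relations impose no condition). The empty set, singletons and $V$ are the trivial modules; $\mathcal R$ is prime if it has no nontrivial module. A hereditary class $\mathcal C$ is minimal prime if it contains infinitely many prime structures (up to isomorphism), while every proper hereditary subclass contains only finitely many prime structures. A quasi-ordered class is well-quasi-ordered if every infinite sequence $x_0,x_1,\ldots$ of its members contains an infinite increasing subsequence $x_{n_0}\le x_{n_1}\le\cdots$ with $n_0<n_1<\cdots$. *)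

(* Defs.v *)
From mathcomp Require Import all_boot all_classical.

Set Implicit Arguments.
Unset Strict Implicit.
Unset Printing Implicit Defensive.

Local Open Scope classical_set_scope.

(* The finite index set of the relations is the disjoint union of [usym]
   (unary symbols) and [bsym] (binary symbols); either part may be empty. *)
Record signature := Signature { usym : finType; bsym : finType }.

(* The carrier is an arbitrary type, possibly empty and possibly infinite. *)
Record relStruct (s : signature) := RelStruct {
  carrier :> Type;
  urel : usym s -> carrier -> Prop;
  brel : bsym s -> carrier -> carrier -> Prop }.

(* Classes of structures are plain predicates rather than [set]s: the library
   type [set] lives in a fixed universe, in which the subsets of carriers live. *)
Section Structures.
Variable s : signature.
Implicit Types (R S : relStruct s) (C D : relStruct s -> Prop).

Definition induced R (A : set R) : relStruct s :=
  @RelStruct s {x : R | A x}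
    (fun i x => urel i (sval x))
    (fun i x y => brel i (sval x) (sval y)).

Definition isomorphic R S : Prop :=
  exists f : R -> S,
    [/\ bijective f,
        forall i x, urel i x <-> urel i (f x) &
        forall i x y, brel i x y <-> brel i (f x) (f y)].

Definition embeds R S : Prop :=
  exists A : set S, isomorphic R (induced A).

Definition finite_struct R : Prop := finite_set [set: R].

(* The age is the isomorphism-closed class, not a set of representatives. *)
Definition age R S : Prop := finite_struct S /\ embeds S R.

Definition is_module R (A : set R) : Prop :=
  forall (a a' x : R) (i : bsym s), A a -> A a' -> ~ A x ->
    (brel i x a <-> brel i x a') /\ (brel i a x <-> brel i a' x).

Definition trivial_subset R (A : set R) : Prop :=
  [\/ A = set0, exists x : R, A = [set x] | A = setT].

(* No lower bound on the cardinality: structures with at most two elements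
   are prime. *)
Definition prime_struct R : Prop :=
  forall A : set R, is_module A -> trivial_subset A.

(* Closure under [embeds] includes closure under isomorphism. *)
Definition hereditary_class C : Prop :=
  (forall R, C R -> finite_struct R) /\
  (forall R S, embeds R S -> C S -> C R).

Definition proper_subclass D C : Prop :=
  (forall R, D R -> C R) /\ (exists R, C R /\ ~ D R).

(* Finitely many up to isomorphism. *)
Definition finitely_many_primes C : Prop :=
  exists (n : nat) (F : 'I_n -> relStruct s),
    forall R, C R -> prime_struct R -> exists i, isomorphic R (F i).

Definition minimal_prime C : Prop :=
  [/\ hereditary_class C,
      ~ finitely_many_primes C &
      forall D, hereditary_class D -> proper_subclass D C ->
        finitely_many_primes D].

End Structures.

Definition well_quasi_ordered (T : Type) (le : T -> T -> Prop)
    (C : T -> Prop) : Prop :=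
  forall x : nat -> T, (forall n, C (x n)) ->
    exists u : nat -> nat,
      (forall k, u k < u k.+1) /\ (forall k, le (x (u k)) (x (u k.+1))).

(* Main.v *)
Require Import Defs.
From mathcomp Require Import all_boot all_classical.

Set Implicit Arguments.
Unset Strict Implicit.
Unset Printing Implicit Defensive.

(** The class [C] is directed by its primes. For [P] in [C], the members of [C]
    that do not embed [P] form a proper hereditary subclass, so only finitely
    many primes of [C] fail to embed [P]; since [C] has infinitely many primes,
    any two members of [C] embed in a common prime of [C]
    ([minimal_prime_directed]). There are countably many finite structures up to
    isomorphism, so one can build an increasing chain of primes of [C] in which
    every member of [C] eventually embeds ([cofinal_prime_chain]). The union of
    the chain has age [C], and it is prime: three points witnessing that a
    module is nontrivial lie in one member of the chain, where the module traces
    a nontrivial module ([limit_prime]).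

    For the well-quasi-order, suppose that [x 0], [x 1], and so on is a bad
    sequence of [C], one in which no term embeds in a later one. The terms after
    [x 0] lie in the class of members of [C] that do not embed [x 0], which has
    finitely many primes. It is thus enough that a hereditary class with finitely
    many primes has no bad sequence ([finitely_many_primes_no_bad_seq]). This is
    Higman's theorem on algebras with finitely many operations of finite arity,
    where each prime [F] acts as the operation that substitutes structures for
    the points of [F]. Every finite structure with at least two points is the
    result of such a substitution by proper modules ([decomposition]); if two
    structures are decomposed over the same [F] and the parts of the first embed
    one by one in those of the second, then the first embeds in the second
    ([embeds_of_fibers]). Take a bad sequence whose terms are successively of
    least cardinality. The proper parts of its terms then admit no bad sequence
    ([below_minimal_bad_seq]). Structures with at most one point being finitely
    many up to isomorphism, infinitely many terms are decomposed over one [F], and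
    Dickson's argument on the finitely many points of [F] gives two terms
    whose parts embed one by one ([embeds_of_decompositions]), contradicting
    badness. *)

(** * Bad sequences *)

Lemma strictly_increasing (u : nat -> nat) :
  (forall k, u k < u k.+1) -> forall i j, i < j -> u i < u j.
Proof. exact: (@homo_ltn _ u (fun i j => i < j) ltn_trans). Qed.

Lemma frequent_subsequence (P : nat -> Prop) :
  (forall n, exists2 m, n <= m & P m) ->
  exists u : nat -> nat, (forall k, u k < u k.+1) /\ forall k, P (u k).
Proof.
move=> freq.
have /choice[h hP] : forall n, exists m, n <= m /\ P m.
  by move=> n; have [m] := freq n; exists m.
exists (fun k => iter k (fun m => h m.+1) (h 0)); split=> [k|[|k]] /=.
- by have [] := hP (iter k (fun m => h m.+1) (h 0)).+1.
- by have [] := hP 0.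
- by have [] := hP (iter k (fun m => h m.+1) (h 0)).+1.
Qed.

Lemma finite_pigeonhole (L : finType) (P : nat -> L -> Prop) :
  (forall n, exists l, P n l) ->
  exists l, exists u : nat -> nat,
    (forall k, u k < u k.+1) /\ forall k, P (u k) l.
Proof.
move=> tot; suff [l freq] : exists l, forall n, exists2 m, n <= m & P m l.
  by exists l; exact: (frequent_subsequence freq).
apply: contrapT => none.
have /choice[b bP] : forall l, exists n, forall m, n <= m -> ~ P m l.
  move=> l; apply: contrapT => nob; apply: none; exists l => n.
  apply: contrapT => nom; apply: nob; exists n => m nm Pm.
  by apply: nom; exists m.
have [l Pl] := tot (\max_l b l).
by apply: bP Pl; apply: leq_bigmax.
Qed.

Section BadSequences.
Variables (T : Type) (le : T -> T -> Prop).
Hypothesis le_trans : forall y x z, le x y -> le y z -> le x z.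

Definition bad_seq (C : T -> Prop) (x : nat -> T) : Prop :=
  (forall n, C (x n)) /\ forall i j, i < j -> ~ le (x i) (x j).

(** Beyond some index every term is below a later one, as otherwise the terms
    that are below no later term would form a bad sequence. *)
Lemma increasing_subsequence (C : T -> Prop) (x : nat -> T) :
  ~ (exists y, bad_seq C y) -> (forall n, C (x n)) ->
  exists u : nat -> nat, (forall k, u k < u k.+1) /\
    forall k, le (x (u k)) (x (u k.+1)).
Proof.
move=> nobad Cx; pose P i := exists2 j, i < j & le (x i) (x j).
have [N PN] : exists N, forall i, N <= i -> P i.
  apply: contrapT => noN.
  have [n|u [uS uP]] := @frequent_subsequence (fun i => ~ P i).
    apply: contrapT => nom; apply: noN; exists n => i ni.
    by apply: contrapT => nPi; apply: nom; exists i.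
  apply: nobad; exists (x \o u); split=> [n|i j ij leij] /=; first exact: Cx.
  by apply: (uP i); exists (u j) => //; apply: strictly_increasing.
have /choice[g gP] : forall i, exists j, N <= i -> i < j /\ le (x i) (x j).
  move=> i; have [Ni|/negP nNi] := boolP (N <= i); last by exists 0.
  by have [j] := PN i Ni; exists j.
have geN k : N <= iter k g N.
  by elim: k => //= k IH; apply: leq_trans IH (ltnW (gP _ IH).1).
by exists (fun k => iter k g N); split=> k; have [] := gP _ (geN k).
Qed.

Lemma increasing_subsequence_lt (C : T -> Prop) (x : nat -> T) :
  ~ (exists y, bad_seq C y) -> (forall n, C (x n)) ->
  exists u : nat -> nat, (forall k, u k < u k.+1) /\
    forall k l, k < l -> le (x (u k)) (x (u l)).
Proof.
move=> nobad Cx; have [u [uS ux]] := increasing_subsequence nobad Cx.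
by exists u; split=> // k l; apply: (@homo_ltn _ (x \o u)).
Qed.

Variable size : T -> nat.

(** Minimality is lexicographic: no term can be made smaller while keeping the
    terms before it, whatever happens to the terms after it. *)
Definition minimal_bad_seq (C : T -> Prop) (x : nat -> T) : Prop :=
  bad_seq C x /\
  forall z n, bad_seq C z -> (forall i, i < n -> z i = x i) ->
    size (x n) <= size (z n).

(** Step [n] minimizes the size of the term of index [n] among the bad sequences
    sharing the first [n] terms already chosen. Later steps leave that term
    unchanged, so the diagonal is the limit of the construction. *)
Lemma exists_minimal_bad_seq (C : T -> Prop) :
  (exists y, bad_seq C y) -> exists x, minimal_bad_seq C x.
Proof.
move=> [y0 bad0].
have /choice[step stepP] : forall p : nat * (nat -> T), exists y,
    bad_seq C p.2 ->
      [/\ bad_seq C y, forall i, i < p.1 -> y i = p.2 i &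
       forall z, bad_seq C z -> (forall i, i < p.1 -> z i = p.2 i) ->
         size (y p.1) <= size (z p.1)].
  move=> [n y] /=.
  have [bady|] := pselect (bad_seq C y); last by exists y.
  pose Q m := `[<exists z, [/\ bad_seq C z, forall i, i < n -> z i = y i &
                               size (z n) = m]>].
  have exQ : exists m, Q m by exists (size (y n)); apply/asboolP; exists y.
  case: (ex_minnP exQ) => m /asboolP[z [badz zy zm]] minm.
  exists z => _; split=> // z' badz' z'y; rewrite zm.
  by apply: minm; apply/asboolP; exists z'.
pose Y := fix Y n := if n is m.+1 then step (m.+1, Y m) else step (0, y0).
have badY n : bad_seq C (Y n).
  by elim: n => [|n IH] /=; [have [] := stepP (0, y0) bad0
                            |have [] := stepP (n.+1, Y n) IH].
have agree n m i : i <= n -> n <= m -> Y m i = Y n i.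
  move=> le_in /subnK<-; elim: (m - n) => //= d IH.
  have [_ same _] := stepP ((d + n).+1, Y (d + n)) (badY _).
  by rewrite -IH; apply: same; rewrite ltnS (leq_trans le_in) ?leq_addl.
exists (fun n => Y n n); split.
  split=> [n|i j ij]; first by have [] := badY n.
  by rewrite -(agree i j) ?(ltnW ij) //; have [_] := badY j; apply.
move=> z [|n] badz zY /=; first by have [_ _] := stepP (0, y0) bad0; apply.
have [_ _] := stepP (n.+1, Y n) (badY n); apply=> // i lt_in /=.
by rewrite zY // (agree i n).
Qed.

(** Nash-Williams' exchange: a bad sequence of smaller elements below the terms
    of a minimal bad sequence [x] could be spliced after an initial segment of
    [x], giving a bad sequence that contradicts minimality. *)
Lemma below_minimal_bad_seq (C : T -> Prop) (x : nat -> T) :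
  minimal_bad_seq C x ->
  ~ exists y, bad_seq
      (fun t => C t /\ exists n, le t (x n) /\ size t < size (x n)) y.
Proof.
move=> [[Cx badx] minx] [y [Cy bady]].
have /choice[n nP] : forall i, exists n, le (y i) (x n) /\
                                  size (y i) < size (x n).
  by move=> i; have [_] := Cy i.
pose Q m := `[<exists i, n i = m>].
have exQ : exists m, Q m by exists (n 0); apply/asboolP; exists 0.
case: (ex_minnP exQ) => m /asboolP[i0 ni0] minm.
(* The smaller sequence is spliced from the index [i0] whose host [x m] comes
   first in [x]; no kept term [x k], [k < m], can lie below a spliced one, whose
   host comes at or after [m]. *)
pose z k := if k < m then x k else y (i0 + (k - m)).
suff badz : bad_seq C z.
  have zx k : k < m -> z k = x k by rewrite /z => ->.
  have := minx z m badz zx.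
  by rewrite /z ltnn subnn addn0 leqNgt -ni0 (nP i0).2.
split=> [k|i j ij]; rewrite /z.
  by case: ifP => // _; have [] := Cy (i0 + (k - m)).
case: (ltnP j m) => jm; first by rewrite (ltn_trans ij jm); apply: badx.
case: (ltnP i m) => im; last first.
  by apply: bady; rewrite ltn_add2l ltn_sub2rE.
move=> le_xy; have [le_yx _] := nP (i0 + (j - m)).
apply: (badx i (n (i0 + (j - m)))); last exact: le_trans le_yx.
by apply: leq_trans im _; apply: minm; apply/asboolP; exists (i0 + (j - m)).
Qed.

End BadSequences.

(** * Embeddings and finite structures *)

Lemma sval_inj (T : Type) (A : T -> Prop) : injective (@sval T A).
Proof. by move=> x y /eq_sig_hprop; apply=> ?; apply: Prop_irrelevance. Qed.

Section Structures.
Variable s : signature.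
Implicit Types R S Q F : relStruct s.

Definition preserves R S (f : R -> S) : Prop :=
  (forall i x, urel i x <-> urel i (f x)) /\
  (forall i x y, brel i x y <-> brel i (f x) (f y)).

Definition embedding R S (f : R -> S) : Prop := injective f /\ preserves f.

Lemma surjective_embedding_isomorphic R S (f : R -> S) :
  embedding f -> (forall y, exists x, f x = y) -> isomorphic R S.
Proof.
move=> [inj_f [fu fb]] surj; exists f; split=> //.
have [g gK] := choice surj.
by exists g => // x; apply: inj_f; rewrite gK.
Qed.

Lemma embedsP R S : embeds R S <-> exists f : R -> S, embedding f.
Proof.
split=> [[A [f [bij_f fu fb]]]|[f [inj_f [fu fb]]]].
  exists (fun x => sval (f x)); split; last by split.
  by move=> x y /sval_inj/(bij_inj bij_f).
exists (range f).
apply: (@surjective_embedding_isomorphic _ (induced (range f))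
          (fun x => exist (range f) (f x) (imageT f x))).
  by split=> [x y [/inj_f]|]; last split.
by move=> [y [x ? fx]]; exists x; apply: eq_exist.
Qed.

Lemma embeds_refl R : embeds R R.
Proof. by apply/embedsP; exists id; split=> //; split. Qed.

Lemma embeds_trans S R Q : embeds R S -> embeds S Q -> embeds R Q.
Proof.
move=> /embedsP[f [inj_f [fu fb]]] /embedsP[g [inj_g [gu gb]]].
apply/embedsP; exists (g \o f); split; first exact: inj_comp.
by split=> [i x|i x y] /=; rewrite ?fu ?fb ?gu ?gb.
Qed.

Lemma embeds_induced R (A : set R) : embeds (induced A) R.
Proof.
by apply/embedsP; exists (@sval _ _); split; [apply: sval_inj | split].
Qed.

Lemma isomorphic_embedding R S :
  isomorphic R S -> exists2 f : R -> S, embedding f & bijective f.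
Proof.
by move=> [f [bij_f fu fb]]; exists f => //; split=> //; apply: bij_inj.
Qed.

Lemma isomorphic_embeds R S : isomorphic R S -> embeds R S.
Proof. by move=> /isomorphic_embedding[f ? _]; apply/embedsP; exists f. Qed.

Lemma isomorphic_sym R S : isomorphic R S -> isomorphic S R.
Proof.
move=> [f [[g fK gK] fu fb]]; exists g; split; first by exists f.
  by move=> i x; rewrite fu gK.
by move=> i x y; rewrite fb !gK.
Qed.

Lemma finite_structP R :
  finite_struct R <-> exists (n : nat) (f : R -> 'I_n), injective f.
Proof.
split=> [[n /card_set_bijP[f [fn inj_f _]]]|[n [f inj_f]]].
  exists n, (fun x => Ordinal (fn x I)) => x y [fxy].
  by apply: inj_f; rewrite ?in_setT.
have := @finite_preimage _ _ [set: 'I_n]%classic f.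
by rewrite preimage_setT; apply=> [x y _ _ /inj_f//|]; apply: finite_finset.
Qed.

Lemma finite_embeds R S : embeds R S -> finite_struct S -> finite_struct R.
Proof.
move=> /embedsP[f [inj_f _]] /finite_structP[n [g inj_g]].
by apply/finite_structP; exists n, (g \o f); apply: inj_comp.
Qed.

Lemma finite_bounded R (h : R -> nat) :
  finite_struct R -> exists K, forall x, h x <= K.
Proof.
move=> /finite_structP[n [f inj_f]].
have /choice[b bP] : forall i : 'I_n, exists k, forall x, f x = i -> h x <= k.
  move=> i; have [[x <-]|nox] := pselect (exists x, f x = i).
    by exists (h x) => y /inj_f->.
  by exists 0 => x fx; case: nox; exists x.
exists (\max_i b i) => x.
by apply: leq_trans (leq_bigmax (f x)); apply: bP.
Qed.

Definition injects_in_ord R (n : nat) : bool :=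
  `[<exists f : R -> 'I_n, injective f>].

(** The cardinality of [R], when finite; taking the least target of an injection
    reduces the comparison of cardinalities to composing injections. *)
Definition struct_card R : nat :=
  if pselect (exists n, injects_in_ord R n) is left ex then ex_minn ex else 0.

Lemma struct_card_lt R S (f : R -> S) (y : S) :
  finite_struct S -> injective f -> (forall x, f x <> y) ->
  struct_card R < struct_card S.
Proof.
move=> /finite_structP finS inj_f missed; rewrite /struct_card.
case: (pselect (exists n, injects_in_ord S n)) => [exS|noS]; last first.
  by case: noS; case: finS => n injS; exists n; apply/asboolP.
case: (ex_minnP exS) => n /asboolP[g inj_g] _.
have n_gt0 : 0 < n by case: n g inj_g => // g; case: (g y).
suff ordR : injects_in_ord R n.-1.
  case: pselect => [exR|]; last by case; exists n.-1.
  case: (ex_minnP exR) => m _ minm.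
  by rewrite -(prednK n_gt0) ltnS minm.
(* As [g \o f] misses the value [g y], that value can be squeezed out. *)
have /choice[h hP] : forall x, exists i, g (f x) = lift (g y) i.
  move=> x; case: (unliftP (g y) (g (f x))) => [i ->|/inj_g/missed[]].
  by exists i.
apply/asboolP; exists h => x x' hxx'.
by apply/inj_f/inj_g; rewrite !hP hxx'.
Qed.

(** * Modules and prime structures *)

(** The three kinds of trivial subset amount to one condition on three points,
    which transfers easily between structures. *)
Lemma primeP R :
  prime_struct R <->
  forall (A : set R) (a a' x : R), is_module A ->
    A a -> A a' -> ~ A x -> a = a'.
Proof.
split=> [primeR A a a' x modA Aa Aa' nAx|trivR A modA].
  case: (primeR A modA) => [A0|[b Ab]|AT].
  - by rewrite A0 in Aa.
  - by move: Aa Aa'; rewrite Ab => -> ->.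
  - by case: nAx; rewrite AT.
have [[x nAx]|full] := pselect (exists x, ~ A x); last first.
  apply: Or33; apply/seteqP; split=> // x _.
  by apply: contrapT => nAx; apply: full; exists x.
have [[a Aa]|void] := pselect (exists a, A a); last first.
  by apply: Or31; apply/seteqP; split=> // a Aa; case: void; exists a.
apply: Or32; exists a; apply/seteqP; split=> [a' Aa'|_ ->//].
exact: (trivR A a' a x).
Qed.

Lemma preimage_module R S (f : R -> S) (A : set S) :
  preserves f -> is_module A -> is_module (f @^-1` A)%classic.
Proof.
move=> [_ fb] modA a a' x i Aa Aa' nAx.
by rewrite !fb; apply: modA.
Qed.

Lemma prime_isomorphic R S : isomorphic R S -> prime_struct R -> prime_struct S.
Proof.
move=> /isomorphic_embedding[f [inj_f fE] [g fK gK]] /primeP primeR.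
apply/primeP=> A a a' x modA Aa Aa' nAx; apply: (can_inj gK).
by apply: (primeR _ _ _ (g x) (preimage_module fE modA)); rewrite /= gK.
Qed.

(** * Modular maps and the decomposition over a prime structure *)

(** The fibers of a modular map are modules, and the source is obtained from [F]
    by substituting a fiber for each point. *)
Definition modular R F (f : R -> F) : Prop :=
  forall i x y, f x <> f y -> (brel i x y <-> brel i (f x) (f y)).

Definition fiber R F (f : R -> F) (p : F) : relStruct s :=
  induced [set x | f x = p]%classic.

Lemma fiber_card_lt R F (f : R -> F) (p : F) (x : R) :
  finite_struct R -> f x <> p -> struct_card (fiber f p) < struct_card R.
Proof.
move=> finR fx.
apply: (@struct_card_lt _ _ (fun y : fiber f p => sval y) x) => //.
  exact: sval_inj.
by move=> [y fy] /= yx; apply: fx; rewrite -yx.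
Qed.

(** Gluing embeddings of the fibers gives an embedding: two points in different
    fibers are sent to different fibers over the same points of [F], and there
    the binary relations are read off [F]. *)
Lemma embeds_of_fibers R S F (f : R -> F) (g : S -> F) :
  modular f -> modular g -> (forall p, embeds (fiber f p) (fiber g p)) ->
  embeds R S.
Proof.
move=> mf mg emb.
have H p : {h : fiber f p -> fiber g p | embedding h}.
  by apply: cid; apply/embedsP.
pose h x : S := sval (sval (H (f x)) (exist _ x erefl)).
(* Two points of one fiber are compared through a single [H p], which needs the
   value of [h] for any proof of membership in the fiber. *)
have hE p x (fx : f x = p) : h x = sval (sval (H p) (exist _ x fx)).
  by case: p / fx.
have gh x : g (h x) = f x by exact: (svalP (sval (H (f x)) _)).
apply/embedsP; exists h; split; last split.
- move=> x y hxy; have fxy : f x = f y by rewrite -!gh hxy.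
  move: hxy; rewrite (hE _ x fxy) (hE _ y erefl).
  case: (svalP (H (f y))) => inj_h _.
  by move=> /sval_inj/inj_h[].
- move=> i x; rewrite (hE _ x erefl).
  by case: (svalP (H (f x))) => _ [/(_ i (exist _ x erefl))].
- move=> i x y; have [fxy|fxy] := pselect (f x = f y); last first.
    by rewrite mf // mg !gh.
  rewrite (hE _ x fxy) (hE _ y erefl).
  by case: (svalP (H (f y))) => _ [_ /(_ i (exist _ x fxy) (exist _ y erefl))].
Qed.

(** Among the nonconstant retractions of [R] onto a transversal of a partition
    into modules, one with the smallest transversal has a prime image: a
    nontrivial module of the image could be collapsed to a point. *)
Lemma prime_retraction R :
  finite_struct R -> (exists x y : R, x <> y) ->
  exists p : R -> R,
    [/\ modular p, exists x y, p x <> p y & prime_struct (induced (range p))].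
Proof.
move=> finR [x0 [y0 x0y0]].
pose Q p :=
  [/\ forall x : R, p (p x) = p x, modular p & exists x y, p x <> p y].
pose P n := `[<exists2 p, Q p & struct_card (induced (range p)) = n>].
have exP : exists n, P n.
  exists (struct_card (induced (range (@id R)))); apply/asboolP.
  exists id => //.
  by split=> //; exists x0, y0.
case: (ex_minnP exP) => n /asboolP[p [pK mp [x1 [y1 pxy]]] card_p] minn.
exists p; split=> //; first by exists x1, y1.
apply/primeP=> A [a ra] [a' ra'] [b rb] modA Aa Aa' nAb; apply: contrapT => aa'.
pose inA x := exists2 rx : range p x, A (exist _ x rx) & True.
have pr x : range p x -> p x = x by move=> [y _ <-].
have Ap x (rx : range p x) : inA x -> A (exist _ x rx).
  by move=> [rx' Ax _]; rewrite (@Prop_irrelevance _ rx rx').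
(* Collapsing [A] onto its point [a] drops [a'] from the transversal, while [b]
   keeps the new retraction from being constant. *)
pose q x := if pselect (inA (p x)) is left _ then a else p x.
have qA x : inA (p x) -> q x = a by rewrite /q; case: pselect.
have qNA x : ~ inA (p x) -> q x = p x by rewrite /q; case: pselect.
have inAa : inA a by exists ra.
have inAa' : inA a' by exists ra'.
have NinAb : ~ inA b by move/(Ap _ rb).
suff [Qq cardq] : Q q /\ struct_card (induced (range q)) < n.
  by move: cardq; rewrite ltnNge minn //; apply/asboolP; exists q.
split; first split.
- move=> x; have [Ax|nAx] := pselect (inA (p x)).
    by rewrite (qA x) // qA // pr.
  by rewrite (qNA x) // qNA pK.
- move=> i x y.
  have [Ax|nAx] := pselect (inA (p x)); have [Ay|nAy] := pselect (inA (p y)).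
  + by rewrite !qA.
  + rewrite (qA x) // (qNA y) // => _.
    have pxpy : p x <> p y by move=> e; apply: nAy; rewrite -e.
    rewrite mp //.
    have := modA (exist _ (p x) (imageT p x)) (exist _ a ra)
                 (exist _ (p y) (imageT p y)) i (Ap _ _ Ax) Aa.
    by case=> [Apy|_ //]; apply: nAy; exists (imageT p y).
  + rewrite (qA y) // (qNA x) // => _.
    have pxpy : p x <> p y by move=> e; apply: nAx; rewrite e.
    rewrite mp //.
    have := modA (exist _ (p y) (imageT p y)) (exist _ a ra)
                 (exist _ (p x) (imageT p x)) i (Ap _ _ Ay) Aa.
    by case=> [Apx|? _ //]; apply: nAx; exists (imageT p x).
  + by rewrite !qNA // => ?; apply: mp.
- exists a, b; rewrite qA ?qNA ?pr // => ab.
  by apply: NinAb; rewrite -ab.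
rewrite -card_p.
have sub x : range q x -> range p x.
  by move=> [y _ <-]; rewrite /q; case: pselect => // _; apply: imageT.
pose h (x : induced (range q)) : induced (range p) :=
  exist _ (sval x) (sub _ (svalP x)).
apply: (@struct_card_lt _ _ h (exist _ a' ra')).
- by apply: finite_embeds finR; apply: embeds_induced.
- by move=> x y [] /sval_inj.
- move=> [x [y _ qy]] [] /= xa'; move: qy; rewrite xa' => qy.
  have [Ay|nAy] := pselect (inA (p y)).
    by apply: aa'; apply: eq_exist; rewrite -qy qA.
  by have py := qNA y nAy; apply: nAy; rewrite -py qy.
Qed.

(** * Classes with finitely many primes are well-quasi-ordered *)

(** Isomorphism types of structures with at most one point: nonemptiness, then
    the unary relations and the loops that hold at the point. *)
Definition trivial_shape : finType :=
  (bool * ({ffun usym s -> bool} * {ffun bsym s -> bool}))%type.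

Definition has_trivial_shape R (t : trivial_shape) : Prop :=
  [/\ forall x y : R, x = y, t.1 <-> exists x : R, True &
      forall x : R, (forall i, urel i x <-> t.2.1 i) /\
                    (forall i, brel i x x <-> t.2.2 i)].

Lemma exists_trivial_shape R :
  (forall x y : R, x = y) -> exists t, has_trivial_shape R t.
Proof.
move=> subR; have [[x _]|void] := pselect (exists x : R, True); last first.
  exists (false, ([ffun=> false], [ffun=> false])); split=> // x.
  by case: void; exists x.
exists (true, ([ffun i => `[<urel i x>]], [ffun i => `[<brel i x x>]])).
split=> //=.
by move=> y; rewrite (subR y x); split=> i; rewrite ffunE asboolE.
Qed.

Lemma same_trivial_shape R S t :
  has_trivial_shape R t -> has_trivial_shape S t -> embeds R S.
Proof.
move=> [subR inhR Rt] [subS inhS St].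
have /choice[f _] : forall x : R, exists y : S, True.
  by move=> x; apply/inhS/inhR; exists x.
apply/embedsP; exists f; split; first by move=> x y _; apply: subR.
split=> [i x|i x y]; first by rewrite (Rt x).1 (St (f x)).1.
by rewrite (subR y x) (Rt x).2 (St (f x)).2.
Qed.

(** The last condition makes every fiber a proper part of [R], so that fibers
    have smaller cardinality. *)
Definition decomposes_over R F : Prop :=
  finite_struct F /\
  exists2 f : R -> F, modular f & forall p, exists x, f x <> p.

(** The image of a retraction with prime image is an induced substructure of [R],
    so it belongs to the class and is one of its finitely many primes. *)
Lemma decomposition (D : relStruct s -> Prop) n (F : 'I_n -> relStruct s) R :
  hereditary_class D ->
  (forall S, D S -> prime_struct S -> exists i, isomorphic S (F i)) ->
  D R -> (exists x y : R, x <> y) -> exists i, decomposes_over R (F i).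
Proof.
move=> [finD herD] FP DR.
move=> /(prime_retraction (finD _ DR))[p [mp [x [y pxy]] primep]].
have Dp : D (induced (range p)) by apply: herD DR; apply: embeds_induced.
have [i iso_i] := FP _ Dp primep; exists i; split.
  by apply: finite_embeds (finD _ Dp); apply/isomorphic_embeds/isomorphic_sym.
have [f [inj_f [_ fb]] _] := isomorphic_embedding iso_i.
pose q x : induced (range p) := exist _ (p x) (imageT p x).
exists (fun x => f (q x)) => [j z t fzt|z].
  by rewrite mp -?fb // => pzt; apply: fzt; congr f; apply: eq_exist.
have [fx|] := pselect (f (q x) = z); last by exists x.
by exists y; rewrite -fx => /inj_f[/esym].
Qed.

(** Dickson's argument: successive extractions, one for each point of [F], make
    all the sequences of fibers increasing at once. *)
Lemma embeds_of_decompositions F (B : relStruct s -> Prop)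
    (R : nat -> relStruct s) (f : forall k, R k -> F) :
  finite_struct F -> ~ (exists Y, bad_seq (@embeds s) B Y) ->
  (forall k, modular (f k)) -> (forall k p, B (fiber (f k) p)) ->
  exists i j, i < j /\ embeds (R i) (R j).
Proof.
move=> /finite_structP[n [e inj_e]] nobad mf Bf.
suff /(_ n)[u [uS uP]] : forall m, exists u : nat -> nat,
    (forall k, u k < u k.+1) /\
    forall p, e p < m -> forall k l, k < l ->
      embeds (fiber (f (u k)) p) (fiber (f (u l)) p).
  exists (u 0), (u 1); split=> //; apply: embeds_of_fibers (mf _) (mf _) _ => p.
  exact: uP.
elim=> [|m [u [uS uP]]]; first by exists id.
have [[p pm]|nop] := pselect (exists p, nat_of_ord (e p) = m); last first.
  exists u; split=> // p; rewrite ltnS leq_eqVlt => /orP[/eqP pm|].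
    by case: nop; exists p.
  exact: uP.
have [v [vS vP]] := @increasing_subsequence_lt _ _ embeds_trans B
  (fun k => fiber (f (u k)) p) nobad (fun k => Bf _ _).
exists (u \o v); split=> [k|q] /=; first exact: strictly_increasing.
rewrite ltnS leq_eqVlt => /orP[/eqP qm|lt_qm] k l kl; last first.
  by apply: uP => //; apply: strictly_increasing.
by rewrite (inj_e q p); [apply: vP|apply/val_inj; rewrite /= qm].
Qed.

(** Infinitely many terms of a minimal bad sequence have the same shape: either
    the isomorphism type of a structure with at most one point, or the prime of a
    decomposition. In the second case the fibers are smaller than the terms and
    embed in them, so they admit no bad sequence. *)
Lemma finitely_many_primes_no_bad_seq (D : relStruct s -> Prop) :
  hereditary_class D -> finitely_many_primes D ->
  ~ exists x, bad_seq (@embeds s) D x.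
Proof.
move=> herD [n [F FP]] /(exists_minimal_bad_seq struct_card)[x minx].
have [[Dx badx] _] := minx; have [finD subD] := herD.
pose shape m (l : trivial_shape + 'I_n) :=
  match l with inl t => has_trivial_shape (x m) t
             | inr i => decomposes_over (x m) (F i) end.
have [m|[t|i] [u [uS ux]]] := @finite_pigeonhole _ shape.
- have [two|one] := pselect (exists a b : x m, a <> b).
    by have [i] := decomposition herD FP (Dx m) two; exists (inr i).
  have [a b|t] := @exists_trivial_shape (x m); last by exists (inl t).
  by apply: contrapT => ab; apply: one; exists a, b.
- by apply: (badx (u 0) (u 1)) => //; apply: same_trivial_shape (ux 0) (ux 1).
have f k : {f : x (u k) -> F i | modular f /\ forall p, exists a, f a <> p}.
  by apply: cid; have [_ [f ? ?]] := ux k; exists f.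
have [k p|k [l [kl emb]]] := embeds_of_decompositions (ux 0).1
  (below_minimal_bad_seq embeds_trans minx) (fun k => (svalP (f k)).1).
  have emb : embeds (fiber (sval (f k)) p) (x (u k)) by exact: embeds_induced.
  split; first exact: subD emb (Dx _).
  exists (u k); split=> //; have [a fa] := (svalP (f k)).2 p.
  exact: fiber_card_lt (finD _ (Dx _)) fa.
exact: badx (strictly_increasing uS kl) emb.
Qed.

(** * Consequences of minimality *)

Definition avoiding (C : relStruct s -> Prop) P : relStruct s -> Prop :=
  fun R => C R /\ ~ embeds P R.

Lemma minimal_prime_avoiding (C : relStruct s -> Prop) P :
  minimal_prime C -> C P ->
  hereditary_class (avoiding C P) /\ finitely_many_primes (avoiding C P).
Proof.
move=> [[finC subC] _ minC] CP.
have her : hereditary_class (avoiding C P).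
  split=> [R [/finC]//|R S RS [CS nPS]].
  by split=> [|PR]; [apply: subC CS | apply: nPS; apply: embeds_trans RS].
split=> //; apply: minC her _; split=> [R []//|].
by exists P; split=> // -[_]; apply; apply: embeds_refl.
Qed.

(** Otherwise every prime of [C] would avoid [P] or [Q], leaving only finitely
    many primes. *)
Lemma minimal_prime_directed (C : relStruct s -> Prop) P Q :
  minimal_prime C -> C P -> C Q ->
  exists S, [/\ C S, prime_struct S, embeds P S & embeds Q S].
Proof.
move=> minC CP CQ; apply: contrapT => none.
have [_ [n [F FP]]] := minimal_prime_avoiding minC CP.
have [_ [m [G GQ]]] := minimal_prime_avoiding minC CQ.
case: minC => _ + _; apply.
exists (n + m), (fun i =>
  match fintype.split i with inl j => F j | inr j => G j end).
move=> S CS primeS; have [PS|nPS] := pselect (embeds P S).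
  have [QS|nQS] := pselect (embeds Q S); first by case: none; exists S.
  have [|j iso_j] := GQ S _ primeS; first by split.
  by exists (unsplit (inr j)); rewrite unsplitK.
have [|j iso_j] := FP S _ primeS; first by split.
by exists (unsplit (inl j)); rewrite unsplitK.
Qed.

Lemma minimal_prime_no_bad_seq (C : relStruct s -> Prop) :
  minimal_prime C -> ~ exists x, bad_seq (@embeds s) C x.
Proof.
move=> minC [x [Cx badx]].
have [her fin] := minimal_prime_avoiding minC (Cx 0).
apply: (finitely_many_primes_no_bad_seq her fin).
exists (fun k => x k.+1); split=> [k|k l kl]; last exact: badx.
by split; [apply: Cx | apply: badx].
Qed.

(** * Countably many finite structures *)

(** A code describes a structure whose carrier is a subset of ['I_n]: a finite
    structure then only needs an injection into ['I_n] to receive a code. *)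
Definition code (n : nat) : finType :=
  ({set 'I_n} * ({set usym s * 'I_n} * {set bsym s * ('I_n * 'I_n)}))%type.

Definition decode (c : {n & code n}) : relStruct s :=
  let: existT n (A, (U, B)) := c in
  induced (R := @RelStruct s 'I_n (fun i x => (i, x) \in U)
                                  (fun i x y => (i, (x, y)) \in B))
          [set x | x \in A]%classic.

Lemma exists_code S : finite_struct S -> exists c, isomorphic S (decode c).
Proof.
move=> /finite_structP[n [f inj_f]].
pose c : code n := ([set m | `[<range f m>]], 
  ([set im | `[<exists2 x, f x = im.2 & urel im.1 x>]],
   [set im | `[<exists x y,
      [/\ f x = im.2.1, f y = im.2.2 & brel im.1 x y]>]]))%SET.
have fA x : f x \in c.1 by rewrite inE; apply/asboolP; exists x.
exists (existT _ n c).
apply: (@surjective_embedding_isomorphic _ (decode (existT _ n c))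
  (fun x => exist _ (f x) (fA x))).
  split=> [x y [] /inj_f//|]; split=> [i x|i x y] /=; rewrite inE asboolE /=.
    by split=> [?|[x' /inj_f->]//]; exists x.
  by split=> [?|[x' [y' [/inj_f-> /inj_f->]]]//]; exists x, y.
move=> [m mA].
have /asboolP[x _ fx] : `[<range f m>] by move: mA; rewrite /= inE.
by exists x; apply: eq_exist.
Qed.

(** * Limits of chains of primes *)

(** Structures on sets of natural numbers, so that a chain of embeddings can be
    turned into a chain of inclusions, whose union is easy to form. *)
Record stage := Stage {
  dom : set nat;
  nurel : usym s -> nat -> Prop;
  nbrel : bsym s -> nat -> nat -> Prop }.

Definition struct_of (t : stage) : relStruct s :=
  induced (R := @RelStruct s nat (nurel t) (nbrel t)) (dom t).

Definition extends (t t' : stage) : Prop :=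
  [/\ forall m, dom t m -> dom t' m,
      forall i m, dom t m -> (nurel t i m <-> nurel t' i m) &
      forall i m m', dom t m -> dom t m' ->
        (nbrel t i m m' <-> nbrel t' i m m')].

Lemma extends_refl t : extends t t.
Proof. by []. Qed.

Lemma extends_trans t' t t'' : extends t t' -> extends t' t'' -> extends t t''.
Proof.
move=> [d u b] [d' u' b']; split=> [m /d/d'//|i m tm|i m m' tm tm'].
  by rewrite u // u' //; apply: d.
by rewrite b // b' //; apply: d.
Qed.

Lemma extends_embeds t t' : extends t t' -> embeds (struct_of t) (struct_of t').
Proof.
move=> [d u b]; apply/embedsP.
exists (fun x : struct_of t => exist _ (sval x) (d _ (svalP x)) : struct_of t').
split; first by move=> x y [] /sval_inj.
by split=> [i [m tm]|i [m tm] [m' tm']] /=; [apply: u|apply: b].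
Qed.

(** [Q] is copied onto natural numbers: the points coming from [t] keep their
    place, and the others go above all the points of [t], which are bounded since
    [t] is finite. *)
Lemma extend_stage t Q :
  finite_struct Q -> embeds (struct_of t) Q ->
  exists2 t', extends t t' & isomorphic Q (struct_of t').
Proof.
move=> finQ tQ; have fint := finite_embeds tQ finQ.
have [K leK] := finite_bounded (fun x : struct_of t => sval x) fint.
have /finite_structP[n [e inj_e]] := finQ.
have /embedsP[f [inj_f [fu fb]]] := tQ.
have /choice[h hP] : forall q, exists m,
    (exists2 x, f x = q & sval x = m) \/
    (~ (exists x, f x = q) /\ m = K.+1 + e q).
  move=> q; have [[x fx]|nox] := pselect (exists x, f x = q).
    by exists (sval x); left; exists x.
  by exists (K.+1 + e q); right.
have hf x : h (f x) = sval x.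
  by case: (hP (f x)) => [[x' /inj_f-> //]|[[]]]; exists x.
have inj_h : injective h.
  move=> q q'.
  case: (hP q) => [[x fx <-]|[_ ->]]; case: (hP q') => [[x' fx' <-]|[_ ->]].
  - by rewrite -fx -fx' => /sval_inj->.
  - by move=> xK; have := leK x; rewrite xK addSn ltnNge leq_addr.
  - by move=> xK; have := leK x'; rewrite -xK addSn ltnNge leq_addr.
  - by move/addnI/val_inj/inj_e.
pose t' := Stage (range h) (fun i m => exists2 q, h q = m & urel i q)
  (fun i m m' => exists q q', [/\ h q = m, h q' = m' & brel i q q']).
exists t'.
  split=> [m tm|i m tm|i m m' tm tm'] /=.
  - by exists (f (exist _ m tm)) => //; rewrite hf.
  - have := fu i (exist _ m tm); have := hf (exist _ m tm) => /= hm ->.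
    split=> [?|[q hq]]; first by exists (f (exist _ m tm)).
    by have /inj_h<- : h q = h (f (exist _ m tm)) by rewrite hq hm.
  - have := fb i (exist _ m tm) (exist _ m' tm').
    have := hf (exist _ m' tm'); have := hf (exist _ m tm) => /= hm hm' ->.
    split=> [?|[q [q' [hq hq']]]].
      by exists (f (exist _ m tm)), (f (exist _ m' tm')).
    have /inj_h<- : h q = h (f (exist _ m tm)) by rewrite hq hm.
    by have /inj_h<- : h q' = h (f (exist _ m' tm')) by rewrite hq' hm'.
apply: (@surjective_embedding_isomorphic _ (struct_of t')
  (fun q => exist _ (h q) (imageT h q))).
  split=> [q q' [] /inj_h//|]; split=> [i q|i q q'] /=.
    by split=> [?|[q0 /inj_h->]//]; exists q.
  by split=> [?|[q0 [q1 [/inj_h-> /inj_h->]]]//]; exists q, q'.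
by move=> [m [q ? hq]]; exists q; apply: eq_exist.
Qed.

(** Going from stage [k] to the next one takes care of the structure coded by
    [k], if there is one and it belongs to [C]. *)
Lemma cofinal_prime_chain (C : relStruct s -> Prop) :
  minimal_prime C ->
  exists t : nat -> stage,
    [/\ forall k, extends (t k) (t k.+1),
        forall k, C (struct_of (t k)) /\ prime_struct (struct_of (t k)) &
        forall S, C S -> exists k, embeds S (struct_of (t k))].
Proof.
move=> minC; have [[finC subC] infC _] := minC.
pose good t := C (struct_of t) /\ prime_struct (struct_of t).
have grow t P : C (struct_of t) -> C P ->
    exists t', [/\ extends t t', good t' & embeds P (struct_of t')].
  move=> Ct CP; have [Q [CQ primeQ tQ PQ]] := minimal_prime_directed minC Ct CP.
  have [t' tt' iso] := extend_stage (finC _ CQ) tQ; exists t'; split=> //.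
    split; last exact: prime_isomorphic primeQ.
    by apply: subC CQ; apply/isomorphic_embeds/isomorphic_sym.
  exact: embeds_trans PQ (isomorphic_embeds iso).
pose listed k P := exists2 c : {n & code n}, unpickle k = Some c & P = decode c.
have /choice[next nextP] : forall kt : nat * stage, exists t', good kt.2 ->
    [/\ extends kt.2 t', good t' &
        forall P, listed kt.1 P -> C P -> embeds P (struct_of t')].
  move=> [k t] /=; have [goodt|] := pselect (good t); last by exists t.
  have [[P [lP CP]]|nolist] := pselect (exists P, listed k P /\ C P).
    have [t' [tt' goodt' Pt']] := grow t P goodt.1 CP.
    exists t' => _; split=> // P' [c' kc' ->] _.
    by case: lP => c kc; move: kc'; rewrite kc => -[<-] <-.
  exists t => _; split=> // P lP CP; case: nolist; by exists P.
have [t0 goodt0] : exists t0, good t0.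
  pose e := Stage set0 (fun _ _ => False) (fun _ _ _ => False).
  have [P CP] : exists P, C P.
    apply: contrapT => voidC; apply: infC.
    by exists 0, (fun=> struct_of e) => P CP; case: voidC; exists P.
  have [Q [CQ primeQ _ _]] := minimal_prime_directed minC CP CP.
  have eQ : embeds (struct_of e) Q.
    apply/embedsP; exists (fun x : struct_of e => False_rect Q (svalP x)).
    by split=> [[m []]|]; split=> ? [m []].
  have [t0 _ iso] := extend_stage (finC _ CQ) eQ; exists t0.
  split; last exact: prime_isomorphic primeQ.
  by apply: subC CQ; apply/isomorphic_embeds/isomorphic_sym.
pose t := fix t k := if k is l.+1 then next (l, t l) else t0.
have goodt k : good (t k) by elim: k => //= k IH; have [] := nextP (k, t k) IH.
exists t; split=> // [k|S CS]; first by have [] := nextP (k, t k) (goodt k).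
have [c iso] := exists_code (finC _ CS); exists (pickle c).+1.
apply: embeds_trans (isomorphic_embeds iso) _.
have [_ _ all_listed] := nextP (pickle c, t (pickle c)) (goodt _).
apply: all_listed; first by exists c; rewrite ?pickleK.
by apply: subC CS; apply/isomorphic_embeds/isomorphic_sym.
Qed.

Section Limit.
Variable t : nat -> stage.
Hypothesis chain : forall k, extends (t k) (t k.+1).

Definition limit_stage : stage :=
  Stage (fun m => exists k, dom (t k) m)
        (fun i m => exists2 k, dom (t k) m & nurel (t k) i m)
        (fun i m m' => exists k,
           [/\ dom (t k) m, dom (t k) m' & nbrel (t k) i m m']).

Lemma chain_extends k l : k <= l -> extends (t k) (t l).
Proof.
move=> /subnK<-; elim: (l - k) => [|d IH]; first exact: extends_refl.
exact: extends_trans IH (chain _).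
Qed.

Lemma extends_limit k : extends (t k) limit_stage.
Proof.
split=> [m tm|i m tm|i m m' tm tm'] /=; first by exists k.
  split=> [um|[l tlm ulm]]; first by exists k.
  have [_ uk _] := chain_extends (leq_maxl k l).
  have [_ ul _] := chain_extends (leq_maxr k l).
  by rewrite uk // -ul.
split=> [bm|[l [tlm tlm' blm]]]; first by exists k.
have [_ _ bk] := chain_extends (leq_maxl k l).
have [_ _ bl] := chain_extends (leq_maxr k l).
by rewrite bk // -bl.
Qed.

Lemma finite_embeds_limit S :
  finite_struct S -> embeds S (struct_of limit_stage) ->
  exists k, embeds S (struct_of (t k)).
Proof.
move=> finS /embedsP[f [inj_f [fu fb]]].
have /choice[h hP] : forall x, exists k, dom (t k) (sval (f x)).
  by move=> x; case: (f x).
have [K leK] := finite_bounded h finS; exists K.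
have dK x : dom (t K) (sval (f x)).
  by have [d _ _] := chain_extends (leK x); apply: d.
have [dl ul bl] := extends_limit K.
apply/embedsP; exists (fun x => exist _ (sval (f x)) (dK x) : struct_of (t K)).
split; last split=> [i x|i x y].
- by move=> x y [] /sval_inj/inj_f.
- by rewrite fu /= ul.
- by rewrite fb /= bl.
Qed.

(** Three points show that a module is nontrivial, and they lie in a common
    stage. *)
Lemma limit_prime :
  (forall k, prime_struct (struct_of (t k))) ->
  prime_struct (struct_of limit_stage).
Proof.
move=> primet; apply/primeP=> A [a [k ka]] [a' [k' ka']] [x [l lx]].
move=> modA Aa Aa' nAx.
pose K := maxn k (maxn k' l).
have [dk _ _] : extends (t k) (t K) by apply/chain_extends/leq_maxl.
have [dk' _ _] : extends (t k') (t K).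
  by apply: chain_extends; rewrite /K maxnCA leq_maxl.
have [dl _ _] : extends (t l) (t K).
  by apply: chain_extends; rewrite /K maxnA leq_maxr.
have [d u b] := extends_limit K.
pose f (y : struct_of (t K)) : struct_of limit_stage :=
  exist _ (sval y) (d _ (svalP y)).
have fE : preserves f.
  by split=> [i [m tm]|i [m tm] [m' tm']] /=; [apply: u|apply: b].
have fy y (Ky : dom (t K) y) ly : f (exist _ y Ky) = exist _ y ly.
  by apply: eq_exist.
have /primeP primeK := primet K.
apply: eq_exist.
have /= := primeK _ (exist _ a (dk _ ka)) (exist _ a' (dk' _ ka'))
          (exist _ x (dl _ lx)) (preimage_module fE modA).
by rewrite (fy _ _ (ex_intro _ k ka)) (fy _ _ (ex_intro _ k' ka'))
  (fy _ _ (ex_intro _ l lx)) => /(_ Aa Aa' nAx)[].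
Qed.

End Limit.
End Structures.

(** * Minimal prime classes *)

Theorem theorem8 (s : signature) (C : relStruct s -> Prop) :
  minimal_prime C ->
  exists R : relStruct s,
    [/\ prime_struct R,
        forall S : relStruct s, C S <-> age R S &
        well_quasi_ordered (@embeds s) (age R)].
Proof.
move=> minC; have [[finC subC] _ _] := minC.
have [t [chain goodt cofinal]] := cofinal_prime_chain minC.
have ageE S : C S <-> age (struct_of (limit_stage t)) S.
  split=> [CS|[finS /(finite_embeds_limit chain finS)[k St]]].
    split; first exact: finC.
    have [k St] := cofinal _ CS.
    exact: embeds_trans St (extends_embeds (extends_limit chain k)).
  by apply: subC St _; have [] := goodt k.
exists (struct_of (limit_stage t)); split=> //.
  by apply: limit_prime => // k; have [] := goodt k.
move=> x agex; apply: (increasing_subsequence (minimal_prime_no_bad_seq minC)).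
by move=> n; apply/ageE.
Qed.
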